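(* Consider a real square matrix $M$ with corresponding I-graph $H = H_M$ and Jacobian DSR graph $G = G_{M,-I}$, where $I$ is the identity matrix of the same size as $M$. The following statements are equivalent: 1. $H$ contains a positive (resp. negative) cycle. 2. $G$ contains an e-cycle (resp. o-cycle). That is, $H$ contains a positive cycle if and only if $G$ contains an e-cycle, and $H$ contains a negative cycle if and only if $G$ contains an o-cycle.
   Context: I-graphs. For a real $n \times n$ matrix $M$, the I-graph $H_M$ is the directed graph with signed edges on vertices $1,\ldots,n$ having a positive directed edge from vertex $j$ to vertex $i$ if $M_{ij}>0$, a negative directed edge from $j$ to $i$ if $M_{ij}<0$, and no directed edge from $j$ to $i$ if $M_{ij}=0$. Diagonal entries of $M$ correspond to self-edges in $H_M$. Directed paths and directed cycles in I-graphs are defined in the natural way. The sign of a cycle is the product of the signs of its edges, so a cycle is positive if it contains an even number of negative edges, and negative otherwise. DSR graphs. Given an ordered pair $(A,B)$ of real $n \times m$ matrices, the DSR graph $G_{A,B}$ is a bipartite signed multigraph with $n$ S-vertices (S-vertex $i$ corresponds to row $i$) and $m$ R-vertices (R-vertex $j$ corresponds to column $j$). Each edge joins an S-vertex and an R-vertex, has a sign, and has S-to-R direction, R-to-S direction, or both (in which case it is called undirected). The edges between S-vertex $i$ and R-vertex $j$ are as follows. If $A_{ij}=B_{ij}=0$ there is none. If $A_{ij} \neq 0$ and $B_{ij} = 0$: a single edge with R-to-S direction and the sign of $A_{ij}$. If $A_{ij}=0$ and $B_{ij} \neq 0$: a single edge with S-to-R direction and the sign of $B_{ij}$. If $A_{ij}B_{ij}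 > 0$: a single undirected edge with the sign of $A_{ij}$. If $A_{ij}B_{ij} < 0$: two edges, one with R-to-S direction and the sign of $A_{ij}$, and one with S-to-R direction and the sign of $B_{ij}$. (Edges of DSR graphs also carry labels, which play no role in this statement.) For a square matrix $M$, the particular DSR graph $G_{M,-I}$ is called the Jacobian DSR graph corresponding to $M$. Cycles in DSR graphs. Cycles respect the directions of edges (undirected edges may be traversed in either direction). All cycles have even length. The sign of a cycle $C$ is the product of the signs of its edges, and its parity is $P(C) = (-1)^{|C|/2}\,\mathrm{sign}(C)$, where $|C|$ is its length. $C$ is an e-cycle if $P(C)=1$ and an o-cycle if $P(C)=-1$. *)

(* Defs.v *)
From HB Require Import structures.
From mathcomp Require Import all_boot all_order all_algebra.
From mathcomp Require Import reals.

Set Implicit Arguments.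
Unset Strict Implicit.
Unset Printing Implicit Defensive.

Import Order.TTheory GRing.Theory Num.Theory.
Local Open Scope ring_scope.

(* [traverses e u v] means that the edge [e] may be followed from [u] to [v];
   an undirected edge may be followed both ways. Edge signs are 1 or -1. *)
Record signed_graph := SignedGraph {
  vertex : eqType;
  edge : Type;
  is_edge : pred edge;
  traverses : edge -> rel vertex;
  edge_sign : edge -> int
}.

(* In a closed walk, each vertex is paired with the edge along which the walk
   leaves it. *)
Definition step (G : signed_graph) (p q : vertex G * edge G) : bool :=
  is_edge p.2 && traverses p.2 p.1 q.1.

(* A cycle is a nonempty closed directed walk without repeated vertices. Only
   the vertices are required to be distinct: a self-edge is a cycle of length
   1, and an undirected edge followed back and forth is a cycle of length 2
   (in whose sign this edge counts twice), exactly as if it were replaced by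
   two opposite directed edges. *)
Definition is_cycle (G : signed_graph) (c : seq (vertex G * edge G)) : bool :=
  [&& (0 < size c)%N, uniq [seq p.1 | p <- c] & cycle (@step G) c].

Definition cycle_sign (G : signed_graph) (c : seq (vertex G * edge G)) : int :=
  \prod_(p <- c) edge_sign p.2.

Definition positive_cycle (G : signed_graph) (c : seq (vertex G * edge G)) :=
  is_cycle c && (cycle_sign c == 1).

Definition negative_cycle (G : signed_graph) (c : seq (vertex G * edge G)) :=
  is_cycle c && (cycle_sign c == -1).

(* Meaningful for cycles of even length only, as all cycles of a bipartite
   graph are. *)
Definition parity (G : signed_graph) (c : seq (vertex G * edge G)) : int :=
  (-1) ^+ (size c)./2 * cycle_sign c.

Definition e_cycle (G : signed_graph) (c : seq (vertex G * edge G)) :=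
  is_cycle c && (parity c == 1).

Definition o_cycle (G : signed_graph) (c : seq (vertex G * edge G)) :=
  is_cycle c && (parity c == -1).

(* The edge [(j, i)] goes from [j] to [i], and corresponds to [M i j]. *)
Definition I_graph (R : realDomainType) (n : nat) (M : 'M[R]_n) :
    signed_graph :=
  @SignedGraph 'I_n ('I_n * 'I_n)%type
    (fun e => M e.2 e.1 != 0)
    (fun e u v => (u == e.1) && (v == e.2))
    (fun e => sgz (M e.2 e.1)).

Inductive direction := StoR | RtoS | Undirected.

Definition allows_StoR (d : direction) : bool :=
  if d is RtoS then false else true.

Definition allows_RtoS (d : direction) : bool :=
  if d is StoR then false else true.

Definition direction_code (d : direction) : bool * bool :=
  (allows_StoR d, allows_RtoS d).

Definition direction_decode (c : bool * bool) : direction :=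
  if c.1 then if c.2 then Undirected else StoR else RtoS.

Lemma direction_codeK : cancel direction_code direction_decode.
Proof. by case. Qed.

HB.instance Definition _ :=
  Equality.copy direction (can_type direction_codeK).

(* The directions and signs of the edges joining S-vertex [i] and R-vertex [j],
   where [a] and [b] are the [(i, j)] entries of the two matrices. *)
Definition DSR_edges (R : realDomainType) (a b : R) : seq (direction * int) :=
  if a == 0 then
    if b == 0 then [::] else [:: (StoR, sgz b)]
  else if b == 0 then [:: (RtoS, sgz a)]
  else if 0 < a * b then [:: (Undirected, sgz a)]
  else [:: (RtoS, sgz a); (StoR, sgz b)].

Record DSR_edge (n m : nat) := DSREdge {
  S_end : 'I_n;
  R_end : 'I_m;
  edge_dir : direction;
  edge_sgn : int
}.

(* [inl i] is S-vertex [i] and [inr j] is R-vertex [j]. *)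
Definition DSR_traverses (n m : nat) (e : DSR_edge n m)
    (u v : 'I_n + 'I_m) : bool :=
  match u, v with
  | inl i, inr j => [&& i == S_end e, j == R_end e & allows_StoR (edge_dir e)]
  | inr j, inl i => [&& i == S_end e, j == R_end e & allows_RtoS (edge_dir e)]
  | _, _ => false
  end.

Definition DSR_graph (R : realDomainType) (n m : nat) (A B : 'M[R]_(n, m)) :
    signed_graph :=
  @SignedGraph ('I_n + 'I_m)%type (DSR_edge n m)
    (fun e => (edge_dir e, edge_sgn e) \in
                DSR_edges (A (S_end e) (R_end e)) (B (S_end e) (R_end e)))
    (@DSR_traverses n m)
    (@edge_sgn n m).

Definition Jacobian_DSR_graph (R : realDomainType) (n : nat) (M : 'M[R]_n) :
    signed_graph :=
  DSR_graph M (- 1%:M).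

(* Main.v *)
Require Import Defs.
From mathcomp Require Import all_boot all_order all_algebra.
From mathcomp Require Import reals.

(** Since [- I] is diagonal, the only way out of S-vertex [j] of the Jacobian
    DSR graph is a negative edge to R-vertex [j], while the edges from R-vertex
    [j] to S-vertex [i] have the sign of [M i j]. Hence the cycles of the DSR
    graph are, up to rotation, the cycles of the I-graph with every edge
    [j -> i] replaced by [S_j -> R_j -> S_i]. This turns [k] edges into [2 k]
    and multiplies the sign by [(-1) ^ k], which the definition of the parity
    cancels. *)

Set Implicit Arguments.
Unset Strict Implicit.
Unset Printing Implicit Defensive.

Import Order.TTheory GRing.Theory Num.Theory.
Local Open Scope ring_scope.

Lemma is_cycle_rot (G : signed_graph) k (c : seq (vertex G * edge G)) :
  is_cycle (rot k c) = is_cycle c.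
Proof. by rewrite /is_cycle size_rot map_rot rot_uniq rot_cycle. Qed.

Lemma parity_rot (G : signed_graph) k (c : seq (vertex G * edge G)) :
  parity (rot k c) = parity c.
Proof.
rewrite /parity size_rot /cycle_sign; congr (_ * _).
by rewrite -[in RHS](cat_take_drop k c) /rot !big_cat [LHS]mulrC.
Qed.

Section JacobianDSR.

Variables (R : realDomainType) (n : nat) (M : 'M[R]_n).

Local Notation H := (I_graph M).
Local Notation G := (Jacobian_DSR_graph M).

(** A negative [M j j] has the sign of the diagonal entry [-1] of [- I], so the two entries then
    share one undirected edge, equal to both [S_edge j] and [R_edge j j]. *)
Definition S_edge (j : 'I_n) : edge G :=
  DSREdge j j (if M j j < 0 then Undirected else StoR) (-1).

Definition R_edge (i j : 'I_n) : edge G :=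
  DSREdge i j (if (i == j) && (M j j < 0) then Undirected else RtoS)
    (sgz (M i j)).

Lemma DSR_edges_diag (a : R) :
  DSR_edges a (-1) =
    if a < 0 then [:: (Undirected, -1)]
    else if a == 0 then [:: (StoR, -1)] else [:: (RtoS, sgz a); (StoR, -1)].
Proof.
rewrite /DSR_edges oppr_eq0 oner_eq0 sgzN1 mulrN1 oppr_gt0.
by case: (ltrgtP a 0) => // a_lt0; rewrite ltr0_sgz.
Qed.

Lemma DSR_edges_offdiag (a : R) :
  DSR_edges a 0 = if a == 0 then [::] else [:: (RtoS, sgz a)].
Proof. by rewrite /DSR_edges eqxx. Qed.

Lemma neg_scalar1E (i j : 'I_n) :
  (- 1%:M : 'M[R]_n) i j = if i == j then -1 else 0.
Proof. by rewrite !mxE; case: eqP; rewrite ?oppr0. Qed.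

(** Parallel edges occur only when [M i i > 0], and then with opposite directions, so the direction
    of travel singles out the edge. *)
Lemma S_stepP (i : 'I_n) (e : edge G) (q : vertex G * edge G) :
  reflect (e = S_edge i /\ q.1 = inr i) (@step G (inl i, e) q).
Proof.
case: q => v f; apply: (iffP idP) => /= [|[-> ->]]; last first.
  rewrite /step /= !neg_scalar1E !eqxx DSR_edges_diag.
  by case: ltP => // _; case: eqP; rewrite !inE ?eqxx ?orbT.
case: v => [k|k]; rewrite /step /= ?andbF // => /andP[].
case: e => a b d s /= e_edge /and3P[/eqP ? /eqP ? d_SR]; subst.
move: e_edge d_SR; rewrite neg_scalar1E; case: eqP => [<-|_]; last first.
  rewrite DSR_edges_offdiag; case: eqP => // _.
  by rewrite inE => /eqP[-> _].
rewrite DSR_edges_diag /S_edge; case: ltP => _.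
  by rewrite inE => /eqP[-> ->].
case: eqP => _; rewrite !inE; first by move=> /eqP[-> ->].
by case/orP=> /eqP[-> ->].
Qed.

Lemma R_stepP (j : 'I_n) (e : edge G) (q : vertex G * edge G) :
  reflect (exists i, [/\ e = R_edge i j, q.1 = inl i & M i j != 0])
    (@step G (inr j, e) q).
Proof.
case: q => v f; apply: (iffP idP) => /= [|[i [-> -> Mij]]]; last first.
  rewrite /step /= neg_scalar1E !eqxx.
  case: (eqVneq i j) Mij => [->|_] Mij /=; last first.
    by rewrite DSR_edges_offdiag (negPf Mij) inE eqxx.
  rewrite DSR_edges_diag (negPf Mij).
  by case: ltP => [Mlt0|_]; rewrite !inE ?(ltr0_sgz Mlt0) ?eqxx.
case: v => [i|k]; rewrite /step /= ?andbF // => /andP[].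
case: e => a b d s /= e_edge /and3P[/eqP ? /eqP ? d_RS]; subst.
exists a; move: e_edge d_RS; rewrite neg_scalar1E /R_edge.
case: (eqVneq a b) => [->|_]; last first.
  rewrite DSR_edges_offdiag; case: eqP => // /eqP Mab.
  by rewrite inE => /eqP[-> ->].
rewrite DSR_edges_diag; case: ltP => [Mlt0|_].
  by rewrite inE => /eqP[-> ->]; rewrite ltr0_sgz // ltr0_neq0.
case: eqVneq => M0; rewrite !inE; first by move=> /eqP[-> _].
by case/orP=> /eqP[-> ->].
Qed.

(** The second edge leaves from [p.2.1] rather than [p.1]: an ill-formed step then lifts to an
    ill-formed one, and the lemmas below are equalities that hold for arbitrary sequences. *)
Definition lift_step (p : vertex H * edge H) : seq (vertex G * edge G) :=
  [:: (inl p.1, S_edge p.1); (inr p.1, R_edge p.2.2 p.2.1)].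

Definition lift_walk (c : seq (vertex H * edge H)) : seq (vertex G * edge G) :=
  flatten [seq lift_step p | p <- c].

Lemma step_lift (p q : vertex H * edge H) (f : edge G) :
  @step G (inr p.1, R_edge p.2.2 p.2.1) (inl q.1, f) = @step H p q.
Proof.
case: p q => [j [a b]] [i g]; apply/R_stepP/idP => /=.
  by case=> k [[-> -> _ _] [->] Mkj]; rewrite /step /= Mkj !eqxx.
by rewrite /step /= => /and3P[Mba /eqP-> /eqP->]; exists b.
Qed.

(** Starting at the R-vertex of [p] suits the induction: steps from S to R in a lift always hold, so
    only the steps from R to S carry a condition. *)
Lemma path_lift (p q : vertex H * edge H) c :
  path (@step G) (inr p.1, R_edge p.2.2 p.2.1)
    (rcons (lift_walk c) (inl q.1, S_edge q.1)) = path (@step H) p (rcons c q).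
Proof.
elim: c p => [|r c IHc] p /=; first by rewrite step_lift.
rewrite step_lift IHc; congr (_ && _).
by have /S_stepP-> : S_edge r.1 = S_edge r.1 /\
    (inr r.1 : vertex G, R_edge r.2.2 r.2.1).1 = inr r.1 by [].
Qed.

Lemma cycle_lift c : cycle (@step G) (lift_walk c) = cycle (@step H) c.
Proof.
case: c => [//|p c]; rewrite [RHS]/= -path_lift /=.
by have /S_stepP-> : S_edge p.1 = S_edge p.1 /\
    (inr p.1 : vertex G, R_edge p.2.2 p.2.1).1 = inr p.1 by [].
Qed.

Lemma size_lift c : size (lift_walk c) = (size c).*2.
Proof. by elim: c => //= p c ->. Qed.

(** Each [j] contributes [inl j] and [inr j] together, so the two freshness tests coincide. *)
Lemma uniq_lift c :
  uniq [seq p.1 | p <- lift_walk c] = uniq [seq p.1 | p <- c].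
Proof.
have memS (j : 'I_n) (d : seq (vertex H * edge H)) :
    ((inl j : vertex G) \in [seq p.1 | p <- lift_walk d]) =
    (j \in [seq p.1 | p <- d]).
  by elim: d => //= p d IHd; rewrite !inE IHd.
have memR (j : 'I_n) (d : seq (vertex H * edge H)) :
    ((inr j : vertex G) \in [seq p.1 | p <- lift_walk d]) =
    (j \in [seq p.1 | p <- d]).
  by elim: d => //= p d IHd; rewrite !inE IHd.
by elim: c => //= p c ->; rewrite inE /= memS memR andbA andbb.
Qed.

Lemma is_cycle_lift c : is_cycle (lift_walk c) = is_cycle c.
Proof. by rewrite /is_cycle size_lift double_gt0 uniq_lift cycle_lift. Qed.

Lemma parity_lift c : parity (lift_walk c) = cycle_sign c.
Proof.
rewrite /parity size_lift doubleK /cycle_sign.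
elim: c => [|p c IHc]; first by rewrite !big_nil mulr1.
rewrite [lift_walk _]/= !big_cons /= -IHc exprS.
by rewrite !mulN1r mulrNN mulrCA.
Qed.

(** The final S-vertex [k] is independent of [j], since the induction removes two steps at the front
    and keeps the end fixed. Ending at an S-vertex forces even length. *)
Lemma path_unlift (j k : 'I_n) (e f : edge G) c :
  path (@step G) (inl j, e) (rcons c (inl k, f)) ->
  exists d, (inl j, e) :: c = lift_walk d.
Proof.
have [m] := ubnP (size c); elim: m c j e => // m IHm c j e.
case: c => [|[v e'] c] /= c_small; first by case/andP=> /S_stepP[].
case/andP=> /S_stepP[-> /= ->].
case: c c_small => [|[w e''] c] /= c_small /andP[/R_stepP[i [-> /= wi _]]].
  by exists [:: (j, (j, i))].
rewrite wi => /IHm[|d ->]; first exact: ltnW.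
by exists ((j, (j, i)) :: d).
Qed.

Lemma is_cycle_unlift (c : seq (vertex G * edge G)) :
  is_cycle c -> exists k d, rot k c = lift_walk d.
Proof.
case: c => [//|[[j|j] e] c] /and3P[_ _ /=].
  by move=> /path_unlift[d defc]; exists 0, d; rewrite rot0.
case: c => [|[v f] c] /=; first by rewrite andbT => /R_stepP[i []].
case/andP=> /R_stepP[i [-> /= -> Mij]].
rewrite rcons_path => /andP[fc c_last].
(* A cycle that starts at an R-vertex starts at an S-vertex after rotation by one. *)
have /path_unlift[d defc] : path (@step G) (inl i, f)
    (rcons (rcons c (inr j, R_edge i j)) (inl i, f)).
  rewrite rcons_path last_rcons rcons_path fc c_last /=.
  by apply/R_stepP; exists i.
by exists 1, d; rewrite -defc rot1_cons.
Qed.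

(** Taking [s] to be [1] or [-1] gives the two equivalences. *)
Lemma sign_parity_cycle (s : int) :
  (exists c, @is_cycle H c && (cycle_sign c == s)) <->
  (exists c, @is_cycle G c && (parity c == s)).
Proof.
split=> [[c]|[c /andP[cyc_c par_c]]].
  by exists (lift_walk c); rewrite is_cycle_lift parity_lift.
have [k [d rot_c]] := is_cycle_unlift cyc_c.
exists d; rewrite -is_cycle_lift -parity_lift -rot_c.
by rewrite is_cycle_rot parity_rot cyc_c.
Qed.

End JacobianDSR.

Theorem theorem9 (R : realType) (n : nat) (M : 'M[R]_n) :
  ((exists c, @positive_cycle (I_graph M) c) <->
   (exists c, @e_cycle (Jacobian_DSR_graph M) c)) /\
  ((exists c, @negative_cycle (I_graph M) c) <->
   (exists c, @o_cycle (Jacobian_DSR_graph M) c)).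
Proof. by split; apply: sign_parity_cycle. Qed.
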